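(* Let $1\le n\le m$ be integers and let $\tilde{B}=\left[\begin{smallmatrix}B\\C\end{smallmatrix}\right]$ be an $m\times n$ integer matrix with $n\times n$ block $B$ and $(m-n)\times n$ block $C$, such that $B$ is skew-symmetrisable and $\operatorname{rank}(\tilde{B})=n$. Let $D$ be a skew-symmetriser of $B$. Then there exist a skew-symmetric $m\times m$ matrix $\Lambda$ with integer coefficients and a multiple $D'=\lambda D$ with $\lambda\in\mathbb{Q}^{+}$ (i.e. $\lambda$ a positive rational number) such that $$\tilde{B}^T\Lambda=\left[\begin{matrix}D'&0\end{matrix}\right],$$ where the right-hand side is the $n\times m$ block matrix consisting of the $n\times n$ matrix $D'$ followed by the $n\times(m-n)$ zero matrix.
   Context: An $n\times n$ integer matrix $B=(b_{i,j})$ is called skew-symmetrisable if there is a diagonal matrix $D=\operatorname{diag}(d_1,\ldots,d_n)$ with positive integer diagonal entries such that $DB$ is skew-symmetric, i.e. $d_ib_{i,j}=-d_jb_{j,i}$ for all $1\le i,j\le n$. Any such $D$ is called a skew-symmetriser of $B$. *)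

(* Defs.v *)
From mathcomp Require Import all_boot all_order all_algebra.
Set Implicit Arguments.
Unset Strict Implicit.
Unset Printing Implicit Defensive.
Import Order.TTheory GRing.Theory Num.Theory.
Local Open Scope ring_scope.

(* The predicate skewmx of sesquilinear is only available over a field. *)
Definition skew_symmetric (n : nat) (A : 'M[int]_n) : Prop := A^T = - A.

(* Entrywise, the last clause is d_i b_(i,j) = - d_j b_(j,i) with d_i = D i i. *)
Definition skew_symmetriser (n : nat) (B D : 'M[int]_n) : Prop :=
  [/\ is_diag_mx D, (forall i, 0 < D i i) & skew_symmetric (D *m B)].

Definition skew_symmetrisable (n : nat) (B : 'M[int]_n) : Prop :=
  exists D : 'M[int]_n, skew_symmetriser B D.

(* Entrywise embedding, for ranks (defined over a field) and rational
   multiples of integer matrices. *)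
Definition rat_mx (m n : nat) (A : 'M[int]_(m, n)) : 'M[rat]_(m, n) :=
  map_mx intr A.

(* Main.v *)
Require Import Defs.
From mathcomp Require Import all_boot all_order all_algebra.
Import Order.TTheory GRing.Theory Num.Theory.
Local Open Scope ring_scope.

(** Let A be the extended exchange matrix, E = [D 0], and let L be an integral
    matrix with L A = c I for some c > 0, obtained by clearing denominators in
    a rational left inverse of A.  As E A = D B is skew-symmetric, so is
    Lambda = c (L^T E - E^T L) - L^T (E A) L, and A^T Lambda = c^2 E since
    A^T L^T = c I and A^T E^T = - E A. *)

Lemma common_denominator_mx (m n : nat) (M : 'M[rat]_(m, n)) :
  exists (c : int) (N : 'M[int]_(m, n)), 0 < c /\ rat_mx N = c%:~R *: M.
Proof.
(* [den i j] omits the denominator of entry [(i, j)] from the full product, so scaling [M i j] by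
   that product gives the integer [numq (M i j) * den i j]. *)
pose den i j : int := \prod_(p : 'I_m * 'I_n | p != (i, j)) denq (M p.1 p.2).
exists (\prod_(p : 'I_m * 'I_n) denq (M p.1 p.2)).
exists (\matrix_(i, j) (numq (M i j) * den i j)).
split; first by apply: prodr_gt0 => p _; apply: denq_gt0.
apply/matrixP => i j; rewrite !mxE (bigD1 (i, j)) //= -/(den i j).
by rewrite !rmorphM /= numqE -[LHS]mulrA [LHS]mulrC.
Qed.

Lemma integral_left_inverse (m n : nat) (A : 'M[int]_(m, n)) :
  \rank (rat_mx A) = n ->
  exists (c : int) (L : 'M[int]_(n, m)), 0 < c /\ L *m A = c%:M.
Proof.
move=> rkA; have /row_fullP[M MA] : row_full (rat_mx A) by apply/eqP.
have [c [L [c_gt0 defL]]] := common_denominator_mx _ _ M.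
exists c, L; split=> //.
have /matrixP eqLA : rat_mx (L *m A) = rat_mx c%:M.
  rewrite {1}/rat_mx map_mxM /= -!/(rat_mx _) defL -scalemxAl MA scalemx1.
  by rewrite /rat_mx map_scalar_mx.
apply/matrixP => i j; apply: (@intr_inj rat).
by have := eqLA i j; rewrite mxE [RHS]mxE.
Qed.

Lemma skew_symmetric_solution (m n : nat) (A : 'M[int]_(m, n))
    (E L : 'M[int]_(n, m)) (c : int) :
  skew_symmetric (E *m A) -> L *m A = c%:M ->
  exists2 X : 'M[int]_m, skew_symmetric X & A^T *m X = (c ^+ 2) *: E.
Proof.
rewrite /skew_symmetric => skEA LA.
have ALt : A^T *m L^T = c%:M by rewrite -trmx_mul LA tr_scalar_mx.
have AEt : A^T *m E^T = - (E *m A) by rewrite -trmx_mul.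
exists (c *: (L^T *m E - E^T *m L) - L^T *m (E *m A) *m L).
  (* The bracket is a matrix minus its transpose; the other term is congruent to the skew-symmetric
     [E *m A]. *)
  rewrite !linearB /= !linearZ /=.
  by rewrite !trmx_mul !trmxK AEt mulNmx mulmxN !opprK mulmxA [_ + c *: - _]addrC.
(* The product becomes [c (c E + E A L) - c E A L], where the terms in [E A L] cancel. *)
rewrite mulmxBr -scalemxAr mulmxBr !mulmxA ALt AEt.
rewrite -!mulmxA !mul_scalar_mx mulNmx opprK scalerDr scalerA -expr2.
by rewrite !mulmxA -addrA subrr addr0.
Qed.

(* Matrices with m rows are typed with n + (m - n) rows, equal to m since n <= m *)
Theorem theorem3p1 (n m : nat) (hn : (1 <= n)%N) (hnm : (n <= m)%N)
    (B : 'M[int]_n) (C : 'M[int]_(m - n, n)) (D : 'M[int]_n)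
    (hB : skew_symmetrisable B)
    (hrank : \rank (rat_mx (col_mx B C)) = n)
    (hD : skew_symmetriser B D) :
  exists (Lambda : 'M[int]_(n + (m - n))) (D' : 'M[rat]_n) (lambda : rat),
    [/\ skew_symmetric Lambda,
        0 < lambda,
        D' = lambda *: rat_mx D
      & rat_mx ((col_mx B C)^T *m Lambda) = row_mx D' 0].
Proof.
case: hD => _ _ skDB.
have [c [L [c_gt0 LA]]] := integral_left_inverse _ _ _ hrank.
(* The zero block of [E] kills [C], leaving [D *m B]. *)
have skEA : skew_symmetric (row_mx D 0 *m col_mx B C).
  by rewrite mul_row_col mul0mx addr0.
have [X skX AX] := skew_symmetric_solution _ _ _ _ _ _ skEA LA.
exists X, ((c ^+ 2)%:~R *: rat_mx D), (c ^+ 2)%:~R; split=> //.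
  by rewrite ltr0z exprn_gt0.
by rewrite AX /rat_mx map_mxZ map_row_mx map_mx0 scale_row_mx scaler0.
Qed.
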